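(* Let $G$ be a finitely generated group in $\mathcal{D}$ and let $S$ be a subgroup of $G$ of finite index. Let $\varphi\colon G\to G$ be an automorphism of finite order of $G$ such that $\varphi(S)=S$. Let $H$ be the HNN-extension $$H=\langle G,t;\ tst^{-1}=\varphi(s),\ s\in S\rangle.$$ There is a subgroup $E\leq S\leq G$ that is a finite index characteristic subgroup of $G$. Furthermore, for any such subgroup $E$ (that is, any subgroup $E\le S$ which is characteristic and of finite index in $G$), $H$ has a finite index subgroup $H'$ isomorphic to $E\times F$, where $F$ is a free group of finite rank.
   Context: $\mathcal{D}$ is the class of finitely generated groups which are virtually a finitely generated subgroup of a direct product of free groups, i.e. which have a finite index subgroup isomorphic to a finitely generated subgroup of a direct product of finitely many free groups. *)

(* Defs.v *)
From HB Require Import structures.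
From mathcomp Require Import all_boot generic_quotient all_classical.

Set Implicit Arguments.
Unset Strict Implicit.
Unset Printing Implicit Defensive.

Local Open Scope classical_set_scope.
Local Open Scope quotient_scope.
Local Open Scope group_scope.

(* Subgroups of a possibly infinite group are classical sets; [in A] is the
   boolean membership predicate of A that group_closed expects. *)
Definition is_subgroup (G : groupType) (A : set G) : Prop :=
  group_closed [in A].

Definition left_coset (G : groupType) (A : set G) (x : G) : set G :=
  [set x * a | a in A].

Definition finite_index (G : groupType) (A : set G) : Prop :=
  finite_set (range (left_coset A)).

Definition fin_gen (G : groupType) (A : set G) : Prop :=
  exists2 X : set G, finite_set X & A = smallest (@is_subgroup G) X.

(* A multiplicative map between groups automatically preserves 1 and inverses,
   so a bijective one is an automorphism. *)
Definition characteristic (G : groupType) (A : set G) : Prop :=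
  forall f : {multiplicative G -> G}, bijective f -> f @` A = A.

Definition finite_order (T : Type) (f : T -> T) : Prop :=
  exists2 n : nat, (0 < n)%N & iter n f =1 id.

(* Isomorphism of the subgroup A of G with the subgroup B of K. The values of f
   outside A are irrelevant. *)
Definition isog (G K : groupType) (A : set G) (B : set K) : Prop :=
  exists2 f : G -> K, {in A &, {morph f : x y / x * y}} & set_bij A B f.

Section DirectProduct.
Variables (I : finType) (T : I -> groupType).
Local Notation prodT := {dffun forall i : I, T i}.

Definition dffun_mul (f g : prodT) : prodT := [ffun i => f i * g i].
Definition dffun_one : prodT := [ffun i => 1].
Definition dffun_inv (f : prodT) : prodT := [ffun i => (f i)^-1].

Fact dffun_mulA : associative dffun_mul.
Proof. by move=> f g h; apply/ffunP=> i; rewrite !ffunE mulgA. Qed.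
Fact dffun_mul1 : left_id dffun_one dffun_mul.
Proof. by move=> f; apply/ffunP=> i; rewrite !ffunE mul1g. Qed.
Fact dffun_mulr1 : right_id dffun_one dffun_mul.
Proof. by move=> f; apply/ffunP=> i; rewrite !ffunE mulg1. Qed.
Fact dffun_mulV : left_inverse dffun_one dffun_inv dffun_mul.
Proof. by move=> f; apply/ffunP=> i; rewrite !ffunE mulVg. Qed.
Fact dffun_mulrV : right_inverse dffun_one dffun_inv dffun_mul.
Proof. by move=> f; apply/ffunP=> i; rewrite !ffunE mulgV. Qed.

HB.instance Definition _ := isGroup.Build prodT
  dffun_mulA dffun_mul1 dffun_mulr1 dffun_mulV dffun_mulrV.

End DirectProduct.

(* Group presentations: the letter (x, false) stands for the generator x and
   (x, true) for its inverse; R u v is the relation u = v. *)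
Definition word (X : Type) := seq (X * bool).

Definition word_inv (X : Type) (w : word X) : word X :=
  rev [seq (l.1, ~~ l.2) | l <- w].

Inductive word_eq (X : Type) (R : word X -> word X -> Prop) :
    word X -> word X -> Prop :=
  | word_eq_refl u : word_eq R u u
  | word_eq_sym u v : word_eq R u v -> word_eq R v u
  | word_eq_trans u v w : word_eq R u v -> word_eq R v w -> word_eq R u w
  | word_eq_cat u v u' v' :
      word_eq R u u' -> word_eq R v v' -> word_eq R (u ++ v) (u' ++ v')
  | word_eq_cancel x b : word_eq R [:: (x, b); (x, ~~ b)] [::]
  | word_eq_rel u v : R u v -> word_eq R u v.

Section Presentation.
Variables (X : choiceType) (R : word X -> word X -> Prop).

Definition word_eqb (u v : word X) : bool := `[< word_eq R u v >].

Fact word_eqb_equiv : equiv_class_of word_eqb.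
Proof.
split=> [u|u v|v u w].
- exact/asboolP/word_eq_refl.
- by apply/asboolP/asboolP; apply: word_eq_sym.
- by move=> /asboolP uv /asboolP vw; apply/asboolP/(word_eq_trans uv).
Qed.

Canonical word_eqb_equiv_rel := EquivRelPack word_eqb_equiv.

Definition presented_group : Type := {eq_quot word_eqb_equiv_rel}.
HB.instance Definition _ := Choice.on presented_group.
HB.instance Definition _ := Quotient.on presented_group.

Definition pres_mul (a b : presented_group) : presented_group :=
  \pi_presented_group (repr a ++ repr b).
Definition pres_one : presented_group := \pi_presented_group [::].
Definition pres_inv (a : presented_group) : presented_group :=
  \pi_presented_group (word_inv (repr a)).

Fact pres_piP (u v : word X) :
  \pi_presented_group u = \pi_presented_group v <-> word_eq R u v.
Proof.
split; first by move=> /eqmodP/asboolP.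
by move=> uv; apply/eqmodP/asboolP.
Qed.

Fact pres_repr (u : word X) : word_eq R (repr (\pi_presented_group u)) u.
Proof. by apply/pres_piP; rewrite reprK. Qed.

Fact word_inv_cat (u v : word X) :
  word_inv (u ++ v) = word_inv v ++ word_inv u.
Proof. by rewrite /word_inv map_cat rev_cat. Qed.

Fact word_invK : involutive (@word_inv X).
Proof.
move=> u; rewrite /word_inv map_rev revK -map_comp -[RHS]map_id.
by apply: eq_map => -[x b] /=; rewrite negbK.
Qed.

Fact word_mulV (u : word X) : word_eq R (u ++ word_inv u) [::].
Proof.
elim: u => [|[x b] u IHu]; first exact: word_eq_refl.
rewrite -cat1s word_inv_cat -catA (catA u) /=.
apply: word_eq_trans (word_eq_cancel R x b).
rewrite -(cat1s (x, b) [:: (x, ~~ b)]).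
apply: (@word_eq_cat _ _ [:: (x, b)]); first exact: word_eq_refl.
exact: (@word_eq_cat _ _ _ _ [::] _ IHu (word_eq_refl _ _)).
Qed.

Fact pres_mulA : associative pres_mul.
Proof.
move=> a b c; apply/pres_piP.
apply: word_eq_trans (word_eq_cat (word_eq_refl _ _) (pres_repr _)) _.
rewrite catA; apply: word_eq_sym.
exact: word_eq_cat (pres_repr _) (word_eq_refl _ _).
Qed.

Fact pres_mul1 : left_id pres_one pres_mul.
Proof.
move=> a; rewrite -[RHS]reprK; apply/pres_piP.
exact: word_eq_cat (pres_repr [::]) (word_eq_refl _ _).
Qed.

Fact pres_mulr1 : right_id pres_one pres_mul.
Proof.
move=> a; rewrite -[RHS]reprK; apply/pres_piP; rewrite -[X in word_eq _ _ X]cats0.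
exact: word_eq_cat (word_eq_refl _ _) (pres_repr [::]).
Qed.

Fact pres_mulrV : right_inverse pres_one pres_inv pres_mul.
Proof.
move=> a; apply/pres_piP; apply: word_eq_trans (word_mulV (repr a)).
exact: word_eq_cat (word_eq_refl _ _) (pres_repr _).
Qed.

Fact pres_mulV : left_inverse pres_one pres_inv pres_mul.
Proof.
move=> a; apply/pres_piP; apply: word_eq_trans (word_mulV (word_inv (repr a))).
rewrite word_invK; exact: word_eq_cat (pres_repr _) (word_eq_refl _ _).
Qed.

HB.instance Definition _ := isGroup.Build presented_group
  pres_mulA pres_mul1 pres_mulr1 pres_mulV pres_mulrV.

End Presentation.

Definition free_group (X : choiceType) : groupType :=
  @presented_group X (fun _ _ => False).

(* < G, t ; t s t^-1 = phi s, s in S >: the generators are the elements of G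
   together with the stable letter t = inr tt, and the multiplication table of
   G is part of the relations. *)
Inductive hnn_rel (G : groupType) (S : set G) (phi : G -> G) :
    word (G + unit) -> word (G + unit) -> Prop :=
  | hnn_mul g h :
      hnn_rel S phi [:: (inl g, false); (inl h, false)]
                    [:: (inl (g * h), false)]
  | hnn_conj s : S s ->
      hnn_rel S phi [:: (inr tt, false); (inl s, false); (inr tt, true)]
                    [:: (inl (phi s), false)].

Definition hnn (G : groupType) (S : set G) (phi : G -> G) : groupType :=
  presented_group (hnn_rel S phi).

(* The class D. The free factors may have arbitrary rank. *)
Definition in_classD (G : groupType) : Prop :=
  fin_gen [set: G] /\
  exists K : set G, [/\ is_subgroup K, finite_index K &
    exists (n : nat) (X : 'I_n -> choiceType)
           (P : set {dffun forall i : 'I_n, free_group (X i)}),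
      [/\ is_subgroup P, fin_gen P & isog K P]].

(* Main.v *)
(* If phi has order n, then H retracts onto the semidirect product of G with
   Z/n, sending t to phi. An element k of the kernel centralizes E, because E is
   normal in H and k e k^-1 and e have the same image, and the retraction is
   injective on G. Hence the preimage of E is the direct product of E with the
   kernel, which is free because it acts freely on the Bass-Serre tree of H.
   Concretely, a Reidemeister-Schreier cocycle with values in the free group F
   on explicit generators of the kernel makes H act on F x Z/n x G, and the
   orbit of (1, 0, 1) recovers each element of H from its coordinates. *)

Require Import Defs.
From HB Require Import structures.
From mathcomp Require Import all_boot all_classical.

Set Implicit Arguments.
Unset Strict Implicit.
Unset Printing Implicit Defensive.

Local Open Scope classical_set_scope.
Local Open Scope quotient_scope.
Local Open Scope group_scope.

(** * Subgroups, cosets and finite index *)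

Lemma is_subgroupP (G : groupType) (A : set G) :
  is_subgroup A <-> A 1 /\ forall x y, A x -> A y -> A (x * y^-1).
Proof.
rewrite /is_subgroup /group_closed !inE.
split=> -[A1 AV]; split=> // x y.
  by move=> Ax Ay; have := AV x y (mem_set Ax) (mem_set Ay); rewrite inE.
by rewrite !inE; apply: AV.
Qed.

Lemma subgroup1 (G : groupType) (A : set G) : is_subgroup A -> A 1.
Proof. by case/is_subgroupP. Qed.

Lemma subgroupV (G : groupType) (A : set G) x : is_subgroup A -> A x -> A x^-1.
Proof. by case/is_subgroupP=> A1 AV Ax; rewrite -[x^-1]mul1g; apply: AV. Qed.

Lemma subgroupM (G : groupType) (A : set G) x y :
  is_subgroup A -> A x -> A y -> A (x * y).
Proof.
move=> As Ax Ay; rewrite -[y]invgK; case/is_subgroupP: (As) => _; apply=> //.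
exact: subgroupV.
Qed.

Lemma morph_group1 (G K : groupType) (f : G -> K) :
  {morph f : x y / x * y} -> f 1 = 1.
Proof. by move=> fM; apply: (mulgI (f 1)); rewrite -fM !mulg1. Qed.

Lemma morph_groupV (G K : groupType) (f : G -> K) :
  {morph f : x y / x * y} -> {morph f : x / x^-1}.
Proof.
by move=> fM x; apply: (mulgI (f x)); rewrite -fM !mulgV morph_group1.
Qed.

Lemma left_cosetP (G : groupType) (A : set G) x y : is_subgroup A ->
  left_coset A x = left_coset A y <-> A (x^-1 * y).
Proof.
move=> As; split=> [xy|Axy].
  have [a Aa <-] : left_coset A x y.
    by rewrite xy; exists 1; [exact: subgroup1 | rewrite mulg1].
  by rewrite mulKg.
apply/seteqP; split=> _ [a Aa <-].
  exists (y^-1 * x * a); last by rewrite !mulgA mulgV mul1g.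
  apply: subgroupM => //; rewrite -[y^-1 * x]invgK invgM invgK.
  exact: subgroupV.
exists (x^-1 * y * a); last by rewrite !mulgA mulgV mul1g.
exact: subgroupM.
Qed.

Lemma finite_index_quotient (G : groupType) (A : set G) :
  is_subgroup A -> finite_index A ->
  exists (T : finType) (q : G -> T) (r : T -> G),
    cancel r q /\ forall x y, q x = q y <-> A (x^-1 * y).
Proof.
move=> As /finite_seqP[L LE].
have qP x : left_coset A x \in L.
  by have : [set` L] (left_coset A x) by rewrite -LE; exists x.
pose q x : seq_sub L := SeqSub (qP x).
have rP (a : seq_sub L) : exists x, q x = a.
  have : [set` L] (val a) by exact: (valP a).
  by rewrite -LE => -[x _ xa]; exists x; apply: val_inj.
have [r qr] := choice rP.
exists (seq_sub L), q, r; split=> // x y.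
by rewrite -(left_cosetP x y As); split=> [/(congr1 val)//|xy]; apply: val_inj.
Qed.

Lemma finite_indexP (G : groupType) (A : set G) (T : finType) (q : G -> T) :
  is_subgroup A -> (forall x y, q x = q y -> A (x^-1 * y)) -> finite_index A.
Proof.
move=> As qA.
(* The default [1] of [xget] never occurs, since [rep] is applied only to values of [q]. *)
pose rep (a : T) : set G := left_coset A (xget 1 [set x | q x = a]).
rewrite /finite_index; have -> : range (left_coset A) = rep @` range q.
  rewrite image_comp.
  apply: eq_imagel => x _ /=; apply/left_cosetP => //; apply: qA.
  by apply/esym; apply: (xgetI 1 (P := [set y | q y = q x]) (x := x)).
exact: finite_image finite_finset.
Qed.

(* The intersection, over all actions of G on a set with [G : S] elements, of
   the kernels; an action is determined by the images of the generators. *)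
Lemma finite_index_characteristic (G : groupType) (S : set G) :
  fin_gen [set: G] -> is_subgroup S -> finite_index S ->
  exists E : set G,
    [/\ is_subgroup E, E `<=` S, finite_index E & characteristic E].
Proof.
move=> [X /finite_seqP[s ->] sG] Ss Sfin.
have [T [q [r [qr qS]]]] := finite_index_quotient Ss Sfin.
pose action (a : G -> {ffun T -> T}) :=
  (forall x, a 1 x = x) /\ forall g h x, a (g * h) x = a g (a h x).
have action_inj a g x y : action a -> a g x = a g y -> x = y.
  by move=> [a1 aM] axy; rewrite -[x]a1 -[y]a1 -(mulVg g) !aM axy.
have action_ext a b : action a -> action b -> {in s, a =1 b} -> a =1 b.
  move=> aP bP ab g.
  (* The elements on which two actions agree form a subgroup, which here contains a generating
     set. *)
  suff: [set g | a g = b g] g by [].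
  have : [set: G] g by []. rewrite sG; apply; split=> [|h /=]; last exact: ab.
  have [[a1 aM] [b1 bM]] := (aP, bP).
  apply/is_subgroupP; split=> [|g1 g2 /= E1 E2]; apply/ffunP=> x.
    by rewrite a1 b1.
  rewrite aM bM E1; congr (b g1 _); apply: (action_inj a g2) => //.
  by rewrite -aM mulgV a1 E2 -bM mulgV b1.
pose E := [set g | forall a, action a -> forall x, a g x = x].
have Es : is_subgroup E.
  apply/is_subgroupP; split=> [a [] //|g h Eg Eh a aP x].
  have [a1 aM] := aP; rewrite aM Eg //; apply: (action_inj a h) => //.
  by rewrite -aM mulgV a1 Eh.
exists E; split=> //.
- move=> g Eg.
  (* Left translation on the cosets of [S]. The representative [r (q 1)] of the trivial coset lies
     in [S] but may differ from [1]. *)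
  pose a h := [ffun x => q (h * r x)].
  have aP : action a.
    split=> [x|h k x]; rewrite !ffunE ?mul1g ?qr //.
    apply/esym/qS; rewrite invgM -!mulgA mulKg.
    exact/qS.
  have [S1 Sg] : S (r (q 1))^-1 /\ S ((r (q 1))^-1 * g * r (q 1)).
    have := Eg a aP (q 1); rewrite ffunE => /esym.
    rewrite -{1}[q 1]qr => /qS; rewrite mulgA => Sg; split=> //.
    by have /qS := qr (q 1); rewrite mulg1.
  have := subgroupM Ss (subgroupM Ss (subgroupV Ss S1) Sg) S1.
  by rewrite invgK -!mulgA mulgV mulg1 mulVKg.
- pose V := {ffun seq_sub s -> {ffun T -> T}}.
  (* The default is junk for those [v] that no action extends. Every action agrees with [ext v] for
     the [v] listing its values on generators, so finitely many functions separate the cosets of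
     [E]. *)
  pose ext (v : V) := xget (fun=> [ffun x => x])
    [set a | action a /\ forall i, a (val i) = v i].
  apply: (@finite_indexP _ _ {ffun V -> {ffun T -> T}}
            (fun g => [ffun v => ext v g])) => // g h gh a aP x.
  have av : exists v, ext v =1 a.
    exists [ffun i => a (val i)]; rewrite /ext.
    case: xgetP => [b _ [bP ba] |/(_ a) []]; last first.
      by split=> // i; rewrite ffunE.
    apply: action_ext => // k ks.
    by rewrite (ba (SeqSub ks)) ffunE.
  have [v va] := av; move/ffunP/(_ v): gh; rewrite !ffunE !va => gh.
  by have [a1 aM] := aP; rewrite aM -gh -aM mulVg a1.
- move=> f [f' fK f'K].
  (* An action composed with an endomorphism is again an action. *)
  have EM h : {morph h : x y / x * y} -> forall g, E g -> E (h g).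
    move=> hM g Eg a [a1 aM] x; apply: (Eg (a \o h)).
    by split=> [y|k k' y] /=; rewrite ?morph_group1 ?hM ?aM.
  apply/seteqP; split=> [_ [g Eg <-]|g Eg]; first exact: (EM f (@gmulfM _ _ f)).
  by exists (f' g) => //; apply: EM => //; exact: can2_gmulfM fK f'K.
Qed.

(** * Actions of presented groups *)

Section Presented.
Variables (X : choiceType) (R : word X -> word X -> Prop).
Local Notation P := (presented_group R).

Definition pgen (x : X) : P := \pi_P [:: (x, false)].

Lemma pi_cat (u v : word X) :
  \pi_P (u ++ v) = (\pi_P u : P) * \pi_P v.
Proof. by apply/pres_piP/word_eq_sym; apply: word_eq_cat; apply: pres_repr. Qed.

Lemma pi_letter (x : X) (b : bool) :
  \pi_P [:: (x, b)] = if b then (pgen x)^-1 else pgen x.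
Proof.
case: b => //; apply: (mulgI (pgen x)); rewrite mulgV -pi_cat.
by apply/pres_piP; apply: word_eq_cancel.
Qed.

Lemma presented_ind (A : set P) :
  is_subgroup A -> (forall x, A (pgen x)) -> forall h, A h.
Proof.
move=> As Ax h; rewrite -[h]reprK; elim: (repr h) => [|[x b] w Aw].
  exact: (subgroup1 As).
rewrite -cat1s pi_cat pi_letter; apply: (subgroupM As) => //.
by case: b => //; apply: (subgroupV As).
Qed.

Variables (T : Type) (p : X * bool -> T -> T).

(** The first letter acts first, so this is a right action. *)
Definition word_act (w : word X) (o : T) : T := foldl (fun o l => p l o) o w.
Definition pres_act (h : P) : T -> T := word_act (repr h).

Hypothesis pK : forall x b, cancel (p (x, b)) (p (x, ~~ b)).
Hypothesis pR : forall u v, R u v -> word_act u =1 word_act v.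

Lemma word_act_eq u v : word_eq R u v -> word_act u =1 word_act v.
Proof.
elim=> {u v} [u|u v _ IH|u v w _ IH1 _ IH2|u v u' v' _ IH1 _ IH2|x b|u v] o //.
- by rewrite IH1.
- by rewrite /word_act !foldl_cat -!/(word_act _ _) IH1 IH2.
- exact: pK.
- exact: pR.
Qed.

Lemma pres_act_pi w : pres_act (\pi_P w) =1 word_act w.
Proof. exact/word_act_eq/pres_repr. Qed.

Lemma pres_act1 o : pres_act 1 o = o.
Proof. exact: pres_act_pi. Qed.

Lemma pres_actM h k o : pres_act (h * k) o = pres_act k (pres_act h o).
Proof. by rewrite pres_act_pi /word_act foldl_cat. Qed.

Lemma pres_act_gen x o : pres_act (pgen x) o = p (x, false) o.
Proof. exact: pres_act_pi. Qed.

Lemma pres_actK h : cancel (pres_act h) (pres_act h^-1).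
Proof. by move=> o; rewrite -pres_actM mulgV pres_act1. Qed.

Lemma pres_actVK h : cancel (pres_act h^-1) (pres_act h).
Proof. by move=> o; rewrite -pres_actM mulVg pres_act1. Qed.

End Presented.

(** Right translations by the [b x] define an action of the free group on [K]. It commutes with left
    translations, so the orbit map of [1] is a morphism. *)
Lemma free_group_lift (X : choiceType) (K : groupType) (b : X -> K) :
  exists2 f : free_group X -> K,
    {morph f : x y / x * y} & forall x, f (pgen _ x) = b x.
Proof.
pose p (l : X * bool) (k : K) := k * if l.2 then (b l.1)^-1 else b l.1.
have pK x c : cancel (p (x, c)) (p (x, ~~ c)).
  by case: c => k; rewrite /p /= ?mulgK ?mulgVK.
have pR (u v : word X) : False -> word_act p u =1 word_act p v by [].
pose a : free_group X -> K -> K := pres_act p.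
have aM h k l : a h (k * l) = k * a h l.
  rewrite /a /pres_act; elim: (repr h) l => //= x w IH l.
  by rewrite -IH /p mulgA.
exists (a^~ 1) => [x y|x]; last by rewrite /a (pres_act_gen pK) // /p mul1g.
by rewrite {1}/a (pres_actM pK) // -/(a _ _) -/(a _ _) -{1}[a x 1]mulg1 aM.
Qed.

(** * The HNN extension and generators of the kernel *)

Section HnnFiniteOrder.
Variables (G : groupType) (S E : set G) (phi psi : G -> G) (m : nat).
Hypotheses (phiM : {morph phi : x y / x * y}).
Hypotheses (phiK : cancel phi psi) (psiK : cancel psi phi).
Hypothesis (phi_order : iter m.+1 phi =1 id).
Hypothesis (phiS : forall x, S x -> S (phi x)).
Hypothesis (psiS : forall x, S x -> S (psi x)).
Hypothesis (phiE : forall x, E x -> E (phi x)).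
Hypothesis (psiE : forall x, E x -> E (psi x)).
Hypothesis (E_sub : is_subgroup E).
Hypothesis (E_normal : forall g x, E x -> E (g^-1 * x * g)).
Variables (T : finType) (q : G -> T) (r : T -> G).
Hypotheses (rK : cancel r q) (qP : forall x y, q x = q y <-> S (x^-1 * y)).

Local Notation H := (hnn S phi).

Definition hnn_base (g : G) : H := pgen (hnn_rel S phi) (inl g).
Definition hnn_stable : H := pgen (hnn_rel S phi) (inr tt).
Local Notation t := hnn_stable.
Local Notation iota := hnn_base.

Lemma psiM : {morph psi : x y / x * y}.
Proof. by move=> x y; apply: (canLR phiK); rewrite phiM !psiK. Qed.

Lemma hnn_baseM : {morph iota : x y / x * y}.
Proof.
by move=> x y; rewrite -pi_cat; apply/esym/pres_piP/word_eq_rel/hnn_mul.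
Qed.

Lemma hnn_base1 : iota 1 = 1. Proof. exact: morph_group1 hnn_baseM. Qed.

Lemma hnn_baseV x : iota x^-1 = (iota x)^-1.
Proof. exact: morph_groupV hnn_baseM x. Qed.

Lemma hnn_stableP s : S s -> t * iota s = iota (phi s) * t.
Proof.
move=> Ss; have : t * iota s * t^-1 = iota (phi s).
  transitivity (\pi_(presented_group (hnn_rel S phi))
      ([:: (inr tt, false)] ++ [:: (inl s, false)] ++ [:: (inr tt, true)])).
    by rewrite !pi_cat (pi_letter _ (inr tt) true) mulgA.
  exact/pres_piP/word_eq_rel/hnn_conj.
by move <-; rewrite mulgVK.
Qed.

Lemma hnn_stable_psi s : S s -> iota s * t = t * iota (psi s).
Proof. by move=> Ss; rewrite hnn_stableP ?psiK //; apply: psiS. Qed.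

(* The kernel of the retraction acts freely on the Bass-Serre tree of H; the
   quotient graph has vertex set Z/(m+1) and, for each coset of S, an edge from
   each i to i+1. Those outside the maximal tree 0 -> 1 -> ... -> m, formed by
   the trivial cosets, index a basis of the kernel. *)
Definition tree_edge (e : 'I_m.+1 * T) : bool := (e.1 < m)%N && (e.2 == q 1).
Definition cotree_edge := {e : 'I_m.+1 * T | ~~ tree_edge e}.
Local Notation rank := #|{: cotree_edge}|.
Local Notation F := (free_group 'I_rank).

(** The cocycle: crossing a cotree edge contributes its basis element, crossing a tree edge
    nothing. *)
Definition edge_elt (i : 'I_m.+1) (a : T) : F :=
  if insub (i, a) is Some e then pgen _ (enum_rank (e : cotree_edge)) else 1.

(** The Schreier generator for the representative [t ^+ i * iota x] and the letter [t]: in the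
    semidirect product their product is [t ^+ ordS i * iota (psi x)]. *)
Definition edge_path (i : 'I_m.+1) (x : G) : H :=
  t ^+ i * iota x * t * (iota (psi x))^-1 * (t ^+ ordS i)^-1.

(** A right factor of [x] from [S] passes [t] as its image under [psi] and cancels there. *)
Lemma edge_path_coset i x y : q x = q y -> edge_path i x = edge_path i y.
Proof.
move=> /qP Sxy; rewrite /edge_path -[in RHS](mulVKg x y) psiM.
rewrite !(hnn_baseM x, hnn_baseM (psi x)).
rewrite (mulgA (t ^+ i)) -[_ * iota (x^-1 * y) * t]mulgA hnn_stable_psi //.
by rewrite invgM !mulgA mulgK.
Qed.

Lemma edge_path_tree (i : 'I_m.+1) a :
  tree_edge (i, a) -> edge_path i (r a) = 1.
Proof.
case/andP=> /= im /eqP->.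
rewrite (edge_path_coset _ (rK (q 1))) /edge_path (morph_group1 psiM) hnn_base1.
by rewrite mulg1 invg1 mulg1 /= modn_small // -expgSr mulgV.
Qed.

Variable (eta : F -> H).
Hypothesis (etaM : {morph eta : x y / x * y}).
Hypothesis (eta_gen : forall e : cotree_edge,
  eta (pgen _ (enum_rank e)) = edge_path (val e).1 (r (val e).2)).

Lemma eta_edge i x : eta (edge_elt i (q x)) = edge_path i x.
Proof.
rewrite -(edge_path_coset i (rK (q x))) /edge_elt.
case: insubP => [e _ ve|]; first by rewrite eta_gen ve.
by rewrite negbK => /edge_path_tree ->; apply: morph_group1.
Qed.

(* Right multiplication of H on itself in the coordinates of cover_elt below:
   (f, i, x) stands for the element eta f * t^i * x of H. *)
Definition cover_act (l : (G + unit) * bool) (o : F * 'I_m.+1 * G) :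
    F * 'I_m.+1 * G :=
  let: (f, i, x) := o in
  match l with
  | (inl g, b) => (f, i, x * if b then g^-1 else g)
  | (inr _, false) => (f * edge_elt i (q x), ordS i, psi x)
  | (inr _, true) =>
      (f * (edge_elt (ord_pred i) (q (phi x)))^-1, ord_pred i, phi x)
  end.

Lemma cover_actK x b : cancel (cover_act (x, b)) (cover_act (x, ~~ b)).
Proof.
case: x b => [g|[]] [] [[f i] x] /=; rewrite ?mulgK ?mulgVK //.
  by rewrite ord_predK phiK.
by rewrite psiK ordSK mulgK.
Qed.

(** Along [t], [s], [t^-1] an edge is crossed and then crossed back: [x] and [x * phi s] lie in one
    coset of [S], so the two contributions cancel. *)
Lemma cover_act_rel u v :
  hnn_rel S phi u v -> word_act cover_act u =1 word_act cover_act v.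
Proof.
case=> {u v} [g h|s Ss] [[f i] x]; rewrite /word_act /= ?mulgA //.
rewrite ordSK phiM psiK.
suff -> : q (x * phi s) = q x by rewrite mulgK.
by apply/esym/qP; rewrite mulKg; apply: phiS.
Qed.

(** * Recovering coordinates from the orbit of the base point *)

Local Notation act := (pres_act cover_act : H -> _ -> _).
Let act1 := pres_act1 cover_actK cover_act_rel.
Let actM := pres_actM cover_actK cover_act_rel.
Let act_gen := pres_act_gen cover_actK cover_act_rel.
Let actK := pres_actK cover_actK cover_act_rel.
Let actVK := pres_actVK cover_actK cover_act_rel.

Definition cover_elt (o : F * 'I_m.+1 * G) : H :=
  let: (f, i, x) := o in eta f * t ^+ i * iota x.

(** It suffices to check generators; for [t], the factor [edge_path] is exactly the correction that
    restores the normal form. *)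
Lemma cover_eltM h o : cover_elt (act h o) = cover_elt o * h.
Proof.
move: h o; apply: presented_ind.
  apply/is_subgroupP; split=> [o|h k Ah Ak o]; first by rewrite act1 ?mulg1.
  rewrite actM; apply: (mulIg k); rewrite -Ak actVK Ah.
  by rewrite mulgA mulgVK.
move=> [g|[]] [[f i] x]; rewrite act_gen /=; first by rewrite hnn_baseM mulgA.
by rewrite etaM eta_edge /edge_path !mulgA !mulgVK.
Qed.

Lemma act_base g f i x : act (iota g) (f, i, x) = (f, i, x * g).
Proof. exact: act_gen. Qed.

Lemma act_baseV g f i x : act (iota g)^-1 (f, i, x) = (f, i, x * g^-1).
Proof. by rewrite -hnn_baseV act_base. Qed.

Lemma act_stable f i x :
  act t (f, i, x) = (f * edge_elt i (q x), ordS i, psi x).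
Proof. exact: act_gen. Qed.

Lemma edge_elt_tree i a : tree_edge (i, a) -> edge_elt i a = 1.
Proof. by move=> ia; rewrite /edge_elt insubN // ia. Qed.

(** The first [m] steps along [t] stay in the maximal tree, so no basis element is collected. *)
Lemma act_stableX f (i : 'I_m.+1) : act (t ^+ i) (f, ord0, 1) = (f, i, 1).
Proof.
case: i => i /=; elim: i => [|i IHi] im.
  by rewrite expg0 act1; congr (_, _, _); apply: val_inj.
rewrite expgSr actM (IHi (ltnW im)) act_stable edge_elt_tree ?mulg1; last first.
  by rewrite /tree_edge /= -ltnS im eqxx.
rewrite (morph_group1 psiM); congr (_, _, _); apply: val_inj => /=.
by rewrite modn_small.
Qed.

(** A Schreier generator goes out along the tree, crosses its own edge and returns along the tree,
    collecting just its basis element. *)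
Lemma act_eta f f' : act (eta f') (f, ord0, 1) = (f * f', ord0, 1).
Proof.
move: f' f; apply: presented_ind.
  apply/is_subgroupP; split=> [f|x y Ax Ay f].
    by rewrite (morph_group1 etaM) act1 ?mulg1.
  rewrite etaM (morph_groupV etaM) actM Ax -[f * x](mulgVK y) -Ay actK.
  by rewrite mulgA.
move=> j f; rewrite -(enum_valK j); move: (enum_val j) => e.
rewrite eta_gen /edge_path; case Ee: (val e) => [i a] /=.
rewrite !actM act_stableX act_base act_stable act_baseV mul1g mulgV rK.
by rewrite -(act_stableX _ (ordS i)) actK /edge_elt -Ee valK.
Qed.

Lemma eta_base_inj f f' x x' :
  eta f * iota x = eta f' * iota x' -> f = f' /\ x = x'.
Proof.
move/(congr1 (act^~ (1, ord0, 1))).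
by rewrite !actM !act_eta !act_base !mul1g => -[-> ->].
Qed.

(** * The kernel centralizes [E] *)

Hypothesis ES : E `<=` S.

Lemma iterE h k x : (forall y, E y -> E (h y)) -> E x -> E (iter k h x).
Proof. by move=> hE Ex; elim: k => //= k; apply: hE. Qed.

Lemma stableX_phi k x : E x -> t ^+ k * iota x = iota (iter k phi x) * t ^+ k.
Proof.
move=> Ex; elim: k => [|k IHk]; first by rewrite expg0 mul1g mulg1.
rewrite expgS -mulgA IHk mulgA hnn_stableP ?mulgA //.
exact/ES/iterE.
Qed.

Lemma iter_psiK k : cancel (iter k psi) (iter k phi).
Proof. by elim: k => // k IHk x; rewrite iterSr /= psiK IHk. Qed.

Lemma stableX_psi k x : E x -> iota x * t ^+ k = t ^+ k * iota (iter k psi x).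
Proof. by move=> Ex; rewrite stableX_phi ?iter_psiK //; apply: iterE. Qed.

(** Only the wrap-around at [i = m] matters; there the finite order of [phi] gives
    [iter m.+1 psi x = x]. *)
Lemma iter_psi_ordS (i : 'I_m.+1) x : iter (ordS i) psi x = iter i.+1 psi x.
Proof.
rewrite /=; case: (ltnP i m) => im; first by rewrite modn_small.
have -> : nat_of_ord i = m by apply/eqP; rewrite eqn_leq im -ltnS ltn_ord.
by rewrite modnn -{1}[x](iter_psiK m.+1) phi_order.
Qed.

Lemma iota_conj g x : iota x * iota g = iota g * iota (g^-1 * x * g).
Proof. by rewrite -!hnn_baseM !mulgA mulgV mul1g. Qed.

(** Moving [x] rightwards through the factors turns it into [e1], [e2], [psi e2], [psi e1] and
    finally [x] again. Each stays in [E], hence in [S], so it can pass [t]. *)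
Lemma edge_path_comm i g x :
  E x -> edge_path i g * iota x = iota x * edge_path i g.
Proof.
move=> Ex; pose e1 := iter i psi x; pose e2 := g^-1 * e1 * g.
have Ee1 : E e1 by apply: iterE.
have Ee2 : E e2 by apply: E_normal.
have e1g :
    iota (psi e2) * (iota (psi g))^-1 = (iota (psi g))^-1 * iota (psi e1).
  rewrite -hnn_baseV -!hnn_baseM /e2 !psiM mulgK.
  by rewrite (morph_groupV psiM).
have e1t : iota (psi e1) * (t ^+ ordS i)^-1 = (t ^+ ordS i)^-1 * iota x.
  apply: (mulgI (t ^+ ordS i)); apply: (mulIg (t ^+ ordS i)).
  rewrite mulVKg !mulgA mulgVK stableX_phi; last exact: psiE.
  by rewrite -[psi e1]/(iter i.+1 psi x) -iter_psi_ordS iter_psiK.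
rewrite /edge_path !mulgA stableX_psi // -/e1.
rewrite -(mulgA (t ^+ i) (iota e1)) iota_conj -/e2 !mulgA.
rewrite -(mulgA _ (iota e2) t) hnn_stable_psi; last exact: ES.
by rewrite !mulgA -(mulgA _ (iota (psi e2))) e1g !mulgA -!mulgA e1t.
Qed.

Lemma eta_comm f x : E x -> eta f * iota x = iota x * eta f.
Proof.
move: f x; apply: presented_ind.
  apply/is_subgroupP; split=> [x Ex|f g Af Ag x Ex].
    by rewrite (morph_group1 etaM) mul1g mulg1.
  rewrite etaM (morph_groupV etaM) mulgA -Af // -!mulgA; congr (_ * _).
  by apply: (mulgI (eta g)); rewrite mulVKg mulgA Ag // mulgK.
by move=> j x Ex; rewrite -(enum_valK j) eta_gen edge_path_comm.
Qed.

(** * The subgroup of finite index *)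

Definition cover_sub : set H := [set eta f * iota x | f in [set: F] & x in E].

Lemma cover_sub_subgroup : is_subgroup cover_sub.
Proof.
apply/is_subgroupP; split.
  exists 1 => //; exists 1; first exact: (subgroup1 E_sub).
  by rewrite (morph_group1 etaM) hnn_base1 mulg1.
move=> _ _ [f _ [x Ex <-]] [g _ [y Ey <-]].
have Exy : E (x * y^-1).
  by apply: (subgroupM E_sub) => //; apply: (subgroupV E_sub).
exists (f * g^-1) => //; exists (x * y^-1) => //.
rewrite etaM -mulgA (@eta_comm g^-1) // hnn_baseM hnn_baseV.
by rewrite (morph_groupV etaM) invgM !mulgA.
Qed.

Lemma cover_sub_finite_index : finite_index E -> finite_index cover_sub.
Proof.
move=> /(finite_index_quotient E_sub)[U [p [_ [_ pP]]]].
(* Coordinates of [h^-1] are used because they put the factor from [eta] last in [h], where left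
   cosets absorb it. *)
pose c (h : H) := let: (_, i, x) := act h^-1 (1, ord0, 1) in (i, p x^-1).
apply: (finite_indexP (q := c) cover_sub_subgroup) => h k.
have dec (l : H) : exists f i x,
    c l = (i, p x^-1) /\ l = (iota x)^-1 * (t ^+ i)^-1 * (eta f)^-1.
  rewrite /c; case El: act => [[f i] x]; exists f, i, x; split=> //.
  have := cover_eltM l^-1 (1, ord0, 1).
  rewrite El /= (morph_group1 etaM) hnn_base1 expg0 !mul1g => lE.
  by rewrite -[l]invgK -lE !invgM mulgA.
have [f [i [x [-> ->]]]] := dec h; have [f' [i' [x' [-> ->]]]] := dec k.
move=> [<- /pP]; rewrite invgK => Exx.
exists (f * f'^-1) => //; exists (iter i phi (x * x'^-1)); first exact: iterE.
rewrite etaM -mulgA (@eta_comm f'^-1); last exact: iterE.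
rewrite !invgM !invgK !mulgA (morph_groupV etaM); congr (_ * _).
rewrite -(mulgK (t ^+ i) (iota _)) -stableX_phi //.
by rewrite hnn_baseM hnn_baseV !mulgA.
Qed.

Lemma cover_sub_isog : isog (E `*` [set: F]) cover_sub.
Proof.
exists (fun z => eta z.2 * iota z.1).
  move=> [x f] [y g]; rewrite !inE /= => -[Ex _] [Ey _].
  by rewrite etaM hnn_baseM !mulgA; congr (_ * _); rewrite -!mulgA eta_comm.
split=> [[x f] [/= Ex _]|[x f] [y g] _ _ /=|_ [f _ [x Ex <-]]].
- by exists f => //; exists x.
- by case/eta_base_inj=> -> ->.
- by exists (x, f).
Qed.

End HnnFiniteOrder.

(** * Assembling the data for a given characteristic subgroup *)

Theorem theorem7p1 (G : groupType) (S : set G) (phi : {multiplicative G -> G})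
  (G_fg : fin_gen [set: G]) (G_D : in_classD G)
  (S_sub : is_subgroup S) (S_fin : finite_index S)
  (phi_bij : bijective phi) (phi_ord : finite_order phi)
  (phi_S : phi @` S = S) :
  (exists E : set G,
     [/\ is_subgroup E, E `<=` S, finite_index E & characteristic E]) /\
  (forall E : set G,
     is_subgroup E -> E `<=` S -> finite_index E -> characteristic E ->
     exists H' : set (hnn S phi),
       [/\ is_subgroup H', finite_index H' &
         exists n : nat, isog (E `*` [set: free_group 'I_n]) H']).
Proof.
split=> [|E E_sub ES E_fin E_char]; first exact: finite_index_characteristic.
have [[|m] // _ phi_iter] := phi_ord.
have [psi phiK psiK] := phi_bij.
have stable (A : set G) : phi @` A = A ->
    (forall x, A x -> A (phi x)) /\ (forall x, A x -> A (psi x)).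
  move=> phiA; split=> x Ax; first by rewrite -phiA; exists x.
  by move: Ax; rewrite -{1}phiA => -[y Ay <-]; rewrite phiK.
have [phiS psiS] := stable _ phi_S.
have [phiE psiE] := stable _ (E_char _ phi_bij).
(* Conjugation is packaged as a multiplicative map so that [E_char] applies to it. *)
have E_normal g x : E x -> E (g^-1 * x * g).
  pose c y := g^-1 * y * g.
  have cM : {morph c : y z / y * z} by move=> y z; rewrite /c !mulgA mulgK.
  pose cm := HB.pack_for {multiplicative G -> G} c
    (isMultiplicative.Build _ _ c cM).
  have c_bij : bijective cm.
    exists (fun y => g * y * g^-1) => y; rewrite /= /c !mulgA.
      by rewrite mulgK mulgV mul1g.
    by rewrite mulgVK mulVg mul1g.
  by move=> Ex; rewrite -(E_char cm c_bij); exists x.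
have [T [q [r [rK qP]]]] := finite_index_quotient S_sub S_fin.
pose b (j : 'I_#|{: cotree_edge m q}|) : hnn S phi :=
  let e := val (enum_val j) in edge_path S phi psi e.1 (r e.2).
have [eta etaM eta_b] := free_group_lift b.
have eta_gen e : eta (pgen _ (enum_rank e)) =
    edge_path S phi psi (val e).1 (r (val e).2).
  by rewrite eta_b /b enum_rankK.
have phiM := @gmulfM _ _ phi.
exists (cover_sub E eta); split.
- exact: (cover_sub_subgroup phiM phiK psiK phi_iter psiS phiE psiE E_sub
            E_normal etaM eta_gen ES).
- exact: (cover_sub_finite_index phiM phiK psiK phi_iter phiS psiS phiE psiE
            E_sub E_normal rK qP etaM eta_gen ES E_fin).
- eexists; exact: (cover_sub_isog phiM phiK psiK phi_iter phiS psiS phiE psiE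
                     E_normal rK qP etaM eta_gen ES).
Qed.
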